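(* Let $(X,\mathcal{A})$ be a measurable space. For every subset $M$ of $M(X)$, $M$ is a fixed maximal ideal of $M(X)$ if and only if there exists a prime ideal $P$ of $\mathcal{A}$ such that $\bigcup P\subsetneq X$ and $M=M^{P}$.
   Context: A measurable space $(X,\mathcal{A})$ is a nonempty set $X$ with a $\sigma$-algebra $\mathcal{A}$ of subsets of $X$. $M(X)$ is the commutative ring (pointwise operations) of all functions $f:X\to\mathbb{R}$ with $f^{-1}(V)\in\mathcal{A}$ for every open $V\subseteq\mathbb{R}$. For $f\in M(X)$, $Z(f)=\{x\in X: f(x)=0\}$ and $\mathrm{coz}(f)=X\setminus Z(f)$. An ideal $I$ of $M(X)$ is fixed if $\bigcap_{f\in I}Z(f)\neq\emptyset$. $\mathcal{A}$ is regarded as a lattice under inclusion. An ideal of $\mathcal{A}$ is a nonempty subset of $\mathcal{A}$ closed under finite unions and under passing to smaller members of $\mathcal{A}$; a prime ideal of $\mathcal{A}$ is a prime element of the lattice $Id(\mathcal{A})$ of all ideals of $\mathcal{A}$ ordered by inclusion, i.e. an ideal $P\neq\mathcal{A}$ such that $J\cap K\subseteq P$ implies $J\subseteq P$ or $K\subseteq P$ for ideals $J,K$ of $\mathcal{A}$. For an ideal $I$ of $\mathcal{A}$, $M^{I}=\{f\in M(X):\mathrm{coz}(f)\in I\}$. *)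

(* Defs.v *)
From mathcomp Require Import all_boot all_order all_algebra.
From mathcomp Require Import all_classical all_reals all_analysis measurable_realfun.

Set Implicit Arguments.
Unset Strict Implicit.
Unset Printing Implicit Defensive.

Import Order.TTheory GRing.Theory Num.Theory.
Import numFieldNormedType.Exports.

Local Open Scope classical_set_scope.
Local Open Scope ring_scope.

(** A measurable space is a [measurableType], whose
    carrier is pointed, hence nonempty; the real line is any [R : realType].
    M(X) is the ring [{mfun X >-> R}] with its pointwise operations.  The
    sigma-algebra on [R] is the Borel one, so that membership in M(X) is the
    condition on preimages of open sets, as [mfun_openP] records. *)

Lemma mfun_openP (d : measure_display) (X : measurableType d) (R : realType)
    (f : X -> R) :
  f \in @mfun d _ X R <->
  (forall V : set R, open V -> measurable (f @^-1` V)).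
Proof.
rewrite inE /=; split=> [mf V oV|fV].
  by rewrite -[f @^-1` V]setTI; apply: mf => //; exact: open_measurable.
apply: (measurability _ (@RGenOpens.measurableE R)).
move=> _ [_ [a [b ->]] <-]; rewrite setTI.
by apply: fV; exact: interval_open.
Qed.

Section Rings.
Context {S : comNzRingType}.
Implicit Types I J : set S.

(** [idealr_closed] already requires [1 \notin I], that is, it defines proper
    ideals. *)
Definition maximal_ideal (I : set S) : Prop :=
  idealr_closed (mem I) /\
  forall J : set S, idealr_closed (mem J) -> I `<=` J -> J = I.

End Rings.

Section MeasurableFunctions.
Context {d : measure_display} {X : measurableType d} {R : realType}.

Definition zero_set (f : {mfun X >-> R}) : set X := [set x | f x = 0].

Definition cozero_set (f : {mfun X >-> R}) : set X := ~` zero_set f.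

Definition fixed (I : set {mfun X >-> R}) : Prop :=
  \bigcap_(f in I) zero_set f !=set0.

End MeasurableFunctions.

Section SigmaAlgebraIdeals.
Context {d : measure_display} {X : measurableType d}.

Definition measurable_ideal (I : set (set X)) : Prop :=
  [/\ I `<=` measurable, I !=set0, setU_closed I &
      forall A B, I A -> measurable B -> B `<=` A -> I B].

Definition prime_measurable_ideal (P : set (set X)) : Prop :=
  [/\ measurable_ideal P, P <> measurable &
      forall J K : set (set X), measurable_ideal J -> measurable_ideal K ->
        J `&` K `<=` P -> J `<=` P \/ K `<=` P].

Definition ideal_mfun {R : realType} (I : set (set X)) : set {mfun X >-> R} :=
  [set f | I (cozero_set f)].

End SigmaAlgebraIdeals.

(* Main.v *)
Require Import Defs.
From mathcomp Require Import all_boot all_order all_algebra.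
From mathcomp Require Import all_classical all_reals all_analysis measurable_realfun.

(** Both sides of the equivalence are parametrized by points of [X].  For
    a point [x], put M_x = {f : f x = 0} ([vanishing_at]) and
    P_x = {A measurable : x is not in A} ([avoiding]).

    The fixed maximal ideals are the M_x: a common zero [x] of the members of
    an ideal I gives I `<=` M_x, and M_x is a proper ideal, so a maximal I
    equals M_x ([fixed_maximal_idealE]).  Conversely M_x is maximal because
    modulo M_x every function is the constant [f x], a unit unless [f] already
    belongs to M_x ([maximal_vanishing_at]).

    The prime ideals whose union misses a point are the P_x: a sigma-algebra
    is complemented, so a prime ideal contains every measurable set or its
    complement ([prime_measurable_idealC]); if the union misses [x], the
    member of the pair that contains [x] is excluded, which forces the other
    one in ([prime_measurable_idealE]).

    Finally M_x is the ideal of the functions with cozero set in P_x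
    ([ideal_mfun_avoiding]), which matches the two families. *)

Set Implicit Arguments.
Unset Strict Implicit.
Unset Printing Implicit Defensive.

Import Order.TTheory GRing.Theory Num.Theory.

Local Open Scope classical_set_scope.
Local Open Scope ring_scope.

Section FixedMaximalIdeals.
Context {d : measure_display} {X : measurableType d} {R : realType}.
Implicit Types (x : X) (f : {mfun X >-> R}) (I : set {mfun X >-> R}).

Definition vanishing_at x : set {mfun X >-> R} := [set f | f x = 0].

Lemma idealr_closed_vanishing_at x : idealr_closed (mem (vanishing_at x)).
Proof.
split.
- by rewrite inE.
- by rewrite notin_setE /vanishing_at /=; apply/eqP; exact: oner_neq0.
- move=> a f g; rewrite !in_setE => fx gx.
  change (a x * f x + g x = 0); by rewrite fx gx mulr0 addr0.
Qed.

(** If [f x != 0], then [1 - (f x)^-1 * f] vanishes at [x], so an ideal that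
    contains M_x and [f] contains 1. *)
Lemma maximal_vanishing_at x : maximal_ideal (vanishing_at x).
Proof.
split; first exact: idealr_closed_vanishing_at.
move=> J [_ J1 Jlin] sub; apply/seteqP; split=> // f Jf.
apply: contrapT => /eqP fx; move/negP: J1; apply.
pose c : {mfun X >-> R} := cst (f x)^-1.
pose g : {mfun X >-> R} := 1 - c * f.
have Jg : J g.
  by apply: sub; change (1 - (f x)^-1 * f x = 0); rewrite mulVf ?subrr.
have -> : (1 : {mfun X >-> R}) = c * f + g by rewrite /g addrC subrK.
by apply: Jlin; rewrite inE.
Qed.

Lemma fixed_vanishing_at x : fixed (vanishing_at x).
Proof. by exists x => f. Qed.

Lemma fixed_maximal_idealE I :
  maximal_ideal I -> fixed I -> exists x, I = vanishing_at x.
Proof.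
move=> [_ Imax] [x Ix]; exists x; apply/esym/Imax => [|f /Ix //].
exact: idealr_closed_vanishing_at.
Qed.

End FixedMaximalIdeals.

Section PrimeMeasurableIdeals.
Context {d : measure_display} {X : measurableType d}.
Implicit Types (x : X) (A B : set X) (P : set (set X)).

Definition avoiding x : set (set X) := [set A | measurable A /\ ~ A x].

(** If [A] in J and [B] in K both contain [x], then so does [A `&` B], which
    lies in both ideals. *)
Lemma prime_avoiding x : prime_measurable_ideal (avoiding x).
Proof.
split.
- split.
  + by move=> A [].
  + by exists set0; split=> //; exact: measurable0.
  + by move=> A B [mA Ax] [mB Bx]; split; [exact: measurableU|case].
  + by move=> A B [_ Ax] mB BA; split=> // /BA.
- move=> e; have : measurable [set: X] by exact: measurableT.
  by rewrite -e => -[_]; apply.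
- move=> J K [Jm _ _ Jdown] [Km _ _ Kdown] JK.
  apply: contrapT => /not_orP[/existsNP[A /not_implyP[JA nA]]].
  move=> /existsNP[B /not_implyP[KB nB]].
  have mAB : measurable (A `&` B) by apply: measurableI; [exact: Jm|exact: Km].
  have [|_ ABx] := JK (A `&` B).
    by split; [apply: Jdown JA _ _|apply: Kdown KB _ _] => // y [].
  apply: ABx; split; apply: contrapT => ?.
  + by apply: nA; split=> //; exact: Jm.
  + by apply: nB; split=> //; exact: Km.
Qed.

Lemma bigcup_avoiding x : \bigcup_(A in avoiding x) A `<` [set: X].
Proof. by split=> // /(_ x I)[A []]. Qed.

Definition principal_ideal A : set (set X) :=
  [set B | measurable B /\ B `<=` A].

Lemma measurable_principal_ideal A : measurable_ideal (principal_ideal A).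
Proof.
split.
- by move=> B [].
- by exists set0; split=> //; exact: measurable0.
- move=> B C [mB BA] [mC CA]; split; first exact: measurableU.
  by rewrite subUset.
- by move=> B C [_ BA] mC CB; split=> //; exact: subset_trans BA.
Qed.

(** The principal ideals of [A] and of its complement meet only in the empty
    set. *)
Lemma prime_measurable_idealC P A :
  prime_measurable_ideal P -> measurable A -> P A \/ P (~` A).
Proof.
move=> [[_ [B PB] _ Pdown] _ Pprime] mA.
have mAC : measurable (~` A) by exact: measurableC.
have [|s|s] := Pprime _ _ (measurable_principal_ideal A)
                          (measurable_principal_ideal (~` A)).
- move=> C [[mC CA] [_ CAC]]; apply: Pdown PB mC _ => y Cy.
  by case: (CAC y Cy); exact: CA.
- by left; apply: s; split.
- by right; apply: s; split.
Qed.

Lemma prime_measurable_idealE P :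
  prime_measurable_ideal P -> \bigcup_(A in P) A `<` [set: X] ->
  exists x, P = avoiding x.
Proof.
move=> Pprime [_ /existsNP[x /not_implyP[_ Px]]]; exists x.
have [[Pm _ _ _] _ _] := Pprime.
apply/seteqP; split=> [A PA|A [mA Ax]].
  by split; [exact: Pm|move=> Ax; apply: Px; exists A].
by have [//|PAC] := prime_measurable_idealC Pprime mA; case: Px; exists (~` A).
Qed.

Lemma measurable_cozero_set (R : realType) (f : {mfun X >-> R}) :
  measurable (cozero_set f).
Proof.
apply: measurableC; rewrite -[zero_set f]setTI.
by apply: (measurable_funPT f _ [set 0]) => //; exact: measurable_set1.
Qed.

Lemma ideal_mfun_avoiding (R : realType) x :
  ideal_mfun (avoiding x) = vanishing_at x :> set {mfun X >-> R}.
Proof.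
apply/seteqP; split=> f; first by move=> [_ /contrapT].
by move=> fx; split; [exact: measurable_cozero_set|apply].
Qed.

End PrimeMeasurableIdeals.

Theorem proposition12 (d : measure_display) (X : measurableType d)
    (R : realType) (M : set {mfun X >-> R}) :
  (maximal_ideal M /\ fixed M) <->
  (exists P : set (set X),
     [/\ prime_measurable_ideal P, \bigcup_(A in P) A `<` [set: X] &
         M = ideal_mfun P]).
Proof.
split=> [[Mmax Mfix]|[P [Pprime PX ->]]].
  have [x ->] := fixed_maximal_idealE Mmax Mfix.
  exists (avoiding x); split; first exact: prime_avoiding.
    exact: bigcup_avoiding.
  by rewrite ideal_mfun_avoiding.
have [x ->] := prime_measurable_idealE Pprime PX.
rewrite ideal_mfun_avoiding; split; first exact: maximal_vanishing_at.
exact: fixed_vanishing_at.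
Qed.
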